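(* Let $\mathcal D\subset\Omega_e$ be a finite set of points, let $U_e$ be the (element-local) DG solution with element average $\overline U_e$, and let $s_e^0\in\mathbb{R}$. Assume $\rho(U_e(x))>0$ for all $x\in\mathcal D$, and $$\rho(\overline U_e)>0,\qquad p(\overline U_e)>\exp(s_e^0)\,\rho^\gamma(\overline U_e).$$ Define $$\tau=\min\Big\{0,\ \min_{x\in\mathcal D}\{p(U_e(x))-\exp(s_e^0)\rho^\gamma(U_e(x))\}\Big\},\qquad\varepsilon=\frac{\tau}{\tau-[p(\overline U_e)-\exp(s_e^0)\rho^\gamma(\overline U_e)]},$$ and ${}^{\mathcal L}U_e=U_e+\varepsilon(\overline U_e-U_e)$. Then $$p\big({}^{\mathcal L}U_e(x)\big)\ \ge\ \exp(s_e^0)\,\rho^\gamma\big({}^{\mathcal L}U_e(x)\big)\qquad\text{for all }x\in\mathcal D.$$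
   Context: States $U=(\rho,\rho u,\rho e)^T$ of the Euler equations with velocity $u\in\mathbb{R}^{N_d}$; $\rho(U)$ is the density component and $p(U)=(\gamma-1)(\rho e-\tfrac12\rho|u|^2)$ is the pressure, with constant $\gamma=1.4$; $\rho^\gamma(U)$ means $(\rho(U))^\gamma$. $\Omega_e$ is a mesh element, $U_e$ is a state-valued polynomial function on $\Omega_e$ and $\overline U_e=\frac{1}{|\Omega_e|}\int_{\Omega_e}U_e\,dx$. The set $\mathcal D$ is the finite set of quadrature points (volume and surface) of $\Omega_e$. The entropy is normalized as $s=\ln p-\gamma\ln\rho$, so that the displayed conclusion expresses $s({}^{\mathcal L}U_e(x))\ge s_e^0$. *)

(* Defs.v *)
From HB Require Import structures.
From mathcomp Require Import all_boot all_order all_algebra finmap.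
From mathcomp Require Import all_classical all_reals all_analysis.
From mathcomp Require mpoly.

Set Implicit Arguments.
Unset Strict Implicit.
Unset Printing Implicit Defensive.

Import Order.TTheory GRing.Theory Num.Theory.
Import numFieldNormedType.Exports.

Local Open Scope classical_set_scope.
Local Open Scope ring_scope.

(* Points of R^n are n-tuples, the type that the library equips with the
   product of the Borel sigma-algebras.  The library has no Lebesgue measure
   on R^n: it is built here as an iterated product measure, transported along
   R^n * R ~ R^(n+1).  Lemma lebesgue_nd_box checks the normalization. *)
Definition cons_point (R : realType) (n : nat)
    (y : n.-tuple R * measurableTypeR R) : n.+1.-tuple R :=
  [the n.+1.-tuple R of (y.2 : R) :: y.1].

Lemma measurable_cons_point (R : realType) (n : nat) :
  measurable_fun [set: n.-tuple R * measurableTypeR R] (@cons_point R n).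
Proof.
apply: (@measurable_cons _ _ _ R
  (fun y : n.-tuple R * measurableTypeR R => y.2 : R) n (fun y => y.1)).
  exact: measurable_snd.
exact: measurable_fst.
Qed.

Definition lebesgue_step (R : realType) (n : nat)
    (m : {measure set (n.-tuple R) -> \bar R}) :
    set (n.+1.-tuple R) -> \bar R :=
  pushforward (m \x @lebesgue_measure R)%E (@cons_point R n).

HB.instance Definition _ (R : realType) (n : nat)
    (m : {measure set (n.-tuple R) -> \bar R}) :=
  Measure.copy (lebesgue_step m)
    (measure_function_pushforward__canonical__measure_function_Measure
       (m \x @lebesgue_measure R)%E (@measurable_cons_point R n)).

Fixpoint lebesgue_nd (R : realType) (n : nat) :
    {measure set (n.-tuple R) -> \bar R} :=
  match n with
  | 0 => [the {measure set (0.-tuple R) -> \bar R} of \d_([tuple])]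
  | n.+1 => [the {measure set (n.+1.-tuple R) -> \bar R}
               of lebesgue_step (lebesgue_nd R n)]
  end.

Lemma lebesgue_nd_box (R : realType) (n : nat) (A : 'I_n -> set R) :
  (forall i, measurable (A i)) ->
  lebesgue_nd R n [set x | forall i, A i (tnth x i)] =
  (\big[*%E/1]_(i < n) lebesgue_measure (A i))%E.
Proof.
elim: n A => [|n IHn] A mA.
  rewrite big_ord0 /= diracE mem_set//= => -[] //.
rewrite big_ord_recl /= /lebesgue_step /pushforward.
have mB : measurable [set x : n.-tuple R | forall i, A (lift ord0 i) (tnth x i)].
  rewrite (_ : [set _ | _] =
      \bigcap_(i in [set: 'I_n]) ((@tnth _ R ^~ i) @^-1` A (lift ord0 i))).
    apply: fin_bigcap_measurable => // i _.
    rewrite -[X in measurable X]setTI; exact: (@measurable_tnth _ R n i).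
  by apply/seteqP; split=> x /= h => [i _|i]; apply: h.
rewrite (_ : _ @^-1` _ =
    [set x : n.-tuple R | forall i, A (lift ord0 i) (tnth x i)] `*` A ord0).
  rewrite product_measure1E//; last exact: mA.
  rewrite muleC; congr (_ * _)%E.
  by apply: IHn => i; exact: mA.
apply/seteqP; split=> -[x r] /=.
  move=> h; split; last by have := h ord0.
  by move=> i; have := h (lift ord0 i); rewrite tnthS.
move=> [hx hr] i; case: (unliftP ord0 i) => [j|] ->; last by [].
by rewrite tnthS; apply: hx.
Qed.

(* A mesh element is only required to be a bounded Borel set of positive
   volume: it may be open or closed, straight-sided or curved. *)
Definition mesh_element (R : realType) (d : nat) (Omega : set (d.-tuple R)) :=
  [/\ measurable Omega,
      (exists M : R, forall x, Omega x -> forall i, `|tnth x i| <= M)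
    & (0 < lebesgue_nd R d Omega)%E].

(* The column (rho, rho u, rho e)^T of conserved variables. *)
Definition state (R : realType) (d : nat) := 'cV[R]_(1 + (d + 1)).

Definition density (R : realType) (d : nat) (U : state R d) : R :=
  usubmx U ord0 ord0.

Definition momentum (R : realType) (d : nat) (U : state R d) : 'cV[R]_d :=
  usubmx (dsubmx U).

Definition total_energy (R : realType) (d : nat) (U : state R d) : R :=
  dsubmx (dsubmx U) ord0 ord0.

Definition velocity (R : realType) (d : nat) (U : state R d) : 'cV[R]_d :=
  (density U)^-1 *: momentum U.

Definition gamma (R : realType) : R := 14%:R / 10%:R.

Definition pressure (R : realType) (d : nat) (U : state R d) : R :=
  (gamma R - 1) * (total_energy U
    - 2%:R^-1 * density U * \sum_(i < d) velocity U i ord0 ^+ 2).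

(* p(U) - exp(s0) rho(U)^gamma, which for positive rho(U) and p(U) has the
   sign of s(U) - s0, where s = ln p - gamma ln rho. *)
Definition entropy_gap (R : realType) (d : nat) (s0 : R) (U : state R d) : R :=
  pressure U - expR s0 * density U `^ gamma R.

Definition polynomial_on (R : realType) (d : nat) (Omega : set (d.-tuple R))
    (U : d.-tuple R -> state R d) :=
  forall k, exists q : mpoly.mpoly d R,
    forall x, Omega x -> U x k ord0 = mpoly.meval (tnth x) q.

Definition average (R : realType) (d : nat) (Omega : set (d.-tuple R))
    (U : d.-tuple R -> state R d) : state R d :=
  \col_k ((fine (lebesgue_nd R d Omega))^-1
          * \int[lebesgue_nd R d]_(x in Omega) U x k ord0).

(* Main.v *)
Require Import Defs.
From mathcomp Require Import all_boot all_order all_algebra finmap.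
From mathcomp Require Import all_classical all_reals all_analysis.
From mathcomp Require Import ring lra.

Set Implicit Arguments.
Unset Strict Implicit.
Unset Printing Implicit Defensive.

Import Order.TTheory GRing.Theory Num.Theory.
Import numFieldNormedType.Exports.

Local Open Scope classical_set_scope.
Local Open Scope ring_scope.

(* Since gamma >= 1, the gap is a concave function of the state on the
   half-space of positive density: pressure is gamma - 1 times total energy minus
   the quadratic-over-linear kinetic energy |m|^2 / (2 rho), and rho `^ gamma is
   convex. The value eps is chosen so that (1 - eps) tau + eps g = 0, where
   g > 0 is the gap of the average; concavity along the segment from U x to the
   average then bounds the gap of the limited state below by this value. *)

(** Joint convexity of the perspective of the square: the convexity defect is an explicit square,
    weighted by [t * (1 - t)], over a positive denominator. *)
Lemma sqr_div_convex (R : realFieldType) (a b r s t : R) :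
  0 < r -> 0 < s -> 0 <= t <= 1 ->
  (a + t * (b - a)) ^+ 2 / (r + t * (s - r))
  <= a ^+ 2 / r + t * (b ^+ 2 / s - a ^+ 2 / r).
Proof.
move=> r0 s0 /andP[t0 t1].
have w0 : 0 < r + t * (s - r) by nra.
rewrite -subr_ge0 (_ : _ - _ = t * (1 - t) * (a * s - b * r) ^+ 2
                              / (r * s * (r + t * (s - r)))); last first.
  by field; rewrite !gt_eqF.
apply: divr_ge0; last by rewrite !mulr_ge0 ?ltW.
by rewrite mulr_ge0 ?sqr_ge0// mulr_ge0// subr_ge0.
Qed.

Lemma powR_segment_convex (R : realType) (p r s t : R) :
  1 <= p -> 0 <= r -> 0 <= s -> 0 <= t <= 1 ->
  (r + t * (s - r)) `^ p <= r `^ p + t * (s `^ p - r `^ p).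
Proof.
move=> p1 r0 s0 /andP[t0 t1].
(* The weight [t] falls on the first point of the convex combination, hence [s] comes before [r]. *)
have := convex_powR p1 (Itv01 t0 t1) (x := s) (y := r).
rewrite !inE/= !in_itv/= !andbT !convRE/= => /(_ s0 r0).
have segE (x y : R) : t * x + (1 - t) * y = y + t * (x - y) by ring.
by rewrite -!segE.
Qed.

Section entropy_gap_concave.
Context (R : realType) (d : nat).
Implicit Types U V : state R d.

Lemma density_segment U V t :
  density (U + t *: (V - U)) = density U + t * (density V - density U).
Proof. by rewrite /density !mxE. Qed.

Lemma momentum_segment U V t i :
  momentum (U + t *: (V - U)) i ord0 =
  momentum U i ord0 + t * (momentum V i ord0 - momentum U i ord0).
Proof. by rewrite /momentum !mxE. Qed.

Lemma total_energy_segment U V t :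
  total_energy (U + t *: (V - U)) =
  total_energy U + t * (total_energy V - total_energy U).
Proof. by rewrite /total_energy !mxE. Qed.

(** Eliminating the velocity splits the kinetic energy into terms of the shape handled by
    [sqr_div_convex]. *)
Lemma pressure_momentum U : 0 < density U ->
  pressure U = (gamma R - 1) * (total_energy U
    - 2%:R^-1 * \sum_(i < d) (momentum U i ord0 ^+ 2 / density U)).
Proof.
move=> U0; rewrite /pressure -mulrA mulr_sumr; congr (_ * (_ - _ * _)).
apply: eq_bigr => i _; rewrite /velocity mxE.
by field; rewrite gt_eqF.
Qed.

Lemma density_segment_gt0 U V t : 0 < density U -> 0 < density V ->
  0 <= t <= 1 -> 0 < density (U + t *: (V - U)).
Proof. by move=> U0 V0 /andP[t0 t1]; rewrite density_segment; nra. Qed.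

Lemma pressure_concave U V t : 0 < density U -> 0 < density V ->
  0 <= t <= 1 ->
  pressure U + t * (pressure V - pressure U) <= pressure (U + t *: (V - U)).
Proof.
move=> U0 V0 t01; have W0 := density_segment_gt0 U0 V0 t01.
rewrite !pressure_momentum// total_energy_segment.
(* Total energy is affine along the segment, so only the kinetic sum needs an estimate, made
   coordinate by coordinate. *)
have := @ler_sum R _ (index_enum 'I_d) xpredT _ _ (fun i _ =>
  sqr_div_convex (momentum U i ord0) (momentum V i ord0) U0 V0 t01).
rewrite big_split/= -mulr_sumr sumrB.
under eq_bigr do rewrite -momentum_segment -density_segment.
set KW := \sum_(i < d) _; set KU := \sum_(i < d) _; set KV := \sum_(i < d) _.
move=> leK; have g1 : 0 <= gamma R - 1 by rewrite /gamma; lra.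
rewrite -mulrBr mulrCA -mulrDr ler_wpM2l//; lra.
Qed.

Lemma entropy_gap_concave s0 U V t : 0 < density U -> 0 < density V ->
  0 <= t <= 1 ->
  entropy_gap s0 U + t * (entropy_gap s0 V - entropy_gap s0 U)
  <= entropy_gap s0 (U + t *: (V - U)).
Proof.
move=> U0 V0 t01; rewrite /entropy_gap.
have := pressure_concave U0 V0 t01.
have g1 : 1 <= gamma R by rewrite /gamma; lra.
have := powR_segment_convex g1 (ltW U0) (ltW V0) t01.
rewrite -density_segment => /(ler_wpM2l (expR_ge0 s0)).
lra.
Qed.

End entropy_gap_concave.

(* tau is the minimum of 0 and of the values over D: 0 is the initial value
   of the iterated minimum. *)
Theorem mainTheorem3 (R : realType) (d : nat)
    (Omega : set (d.-tuple R)) (hOmega : mesh_element Omega)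
    (D : {fset d.-tuple R}) (hD : forall x, x \in D -> Omega x)
    (U : d.-tuple R -> state R d) (hU : polynomial_on Omega U)
    (s0 : R)
    (hrho : forall x, x \in D -> 0 < density (U x))
    (hrho_avg : 0 < density (average Omega U))
    (hp_avg : pressure (average Omega U)
              > expR s0 * density (average Omega U) `^ gamma R) :
  let Ubar := average Omega U in
  let tau := \big[Num.min/0]_(x <- D) entropy_gap s0 (U x) in
  let eps := tau / (tau - entropy_gap s0 Ubar) in
  let LU := fun x => U x + eps *: (Ubar - U x) in
  forall x, x \in D ->
    pressure (LU x) >= expR s0 * density (LU x) `^ gamma R.
Proof.
move=> Ubar tau eps LU x xD.
have g0 : 0 < entropy_gap s0 Ubar by rewrite subr_gt0.
have tau0 : tau <= 0 by exact: bigmin_le_id.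
have taux : tau <= entropy_gap s0 (U x) by exact: ge_bigmin_seq.
have den0 : 0 < entropy_gap s0 Ubar - tau by lra.
(* Changing both signs makes the numerator nonnegative and the denominator positive. *)
have epsE : eps = (- tau) / (entropy_gap s0 Ubar - tau).
  by rewrite /eps -opprB invrN mulrN mulNr.
have eps01 : 0 <= eps <= 1.
  by rewrite epsE divr_ge0 ?ler_pdivrMr//=; lra.
have eps_balance : (1 - eps) * tau + eps * entropy_gap s0 Ubar = 0.
  by rewrite epsE; field; rewrite gt_eqF.
rewrite -subr_ge0.
apply: le_trans (entropy_gap_concave s0 (hrho x xD) hrho_avg eps01).
(* Add [(1 - eps) * (entropy_gap s0 (U x) - tau) >= 0] to [eps_balance]. *)
case/andP: eps01 => e0 e1; nra.
Qed.
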